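(* Let $\lambda<0$ be a real number and $n\ge 1$ an integer. Then the (standard) isometric immersion $$\phi: S^n\left(\sqrt{\tfrac{n}{-\lambda}}\right)\to\mathbb{E}^{n+1}$$ of the round $n$-sphere of radius $\sqrt{n/(-\lambda)}$ is non-trivial biminimal for this $\lambda$; that is, it is not minimal and its mean curvature vector $\mathbf{H}$ satisfies $$\Delta^{\perp}\mathbf{H}-\sum_{i=1}^n h(A_{\mathbf{H}}e_i,e_i)=\lambda\,\mathbf{H}.$$
   Context: $S^n(r)$ denotes the round $n$-sphere of radius $r$, embedded in Euclidean space $\mathbb{E}^{n+1}=(\mathbb{R}^{n+1},\langle\ ,\ \rangle)$ in the standard way as a hypersphere. For an isometrically immersed $n$-dimensional submanifold $M$ of Euclidean space, $\nabla$ and $D$ are the Levi-Civita connections of $M$ and of the ambient Euclidean space. The second fundamental form $h$ is defined by $D_XY=\nabla_XY+h(X,Y)$; for a normal field $\xi$, the Weingarten map $A_\xi$ and the normal connection $\nabla^\perp$ are defined by $D_X\xi=-A_\xi X+\nabla^\perp_X\xi$. The mean curvature vector is $\mathbf{H}=\frac1n\sum_{i=1}^n h(e_i,e_i)$ with $\{e_i\}$ a local orthonormal frame of $TM$, and $\Delta^\perp=\sum_{i=1}^n\left(\nabla^\perp_{e_i}\nabla^\perp_{e_i}-\nabla^\perp_{\nabla_{e_i}e_i}\right)$ is the non-positive normal Laplacian. A submanifold is called biminimal (for a constant $\lambda\in\mathbb{R}$) if the immersion is a critical point of $E_2+\lambda E$ (bi-energy plus $\lambda$ times energy) under variations normal to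 the submanifold; in Euclidean space the corresponding Euler-Lagrange condition is exactly $\Delta^{\perp}\mathbf{H}-\sum_{i=1}^n h(A_{\mathbf{H}}e_i,e_i)=\lambda\mathbf{H}$. Minimal means $\mathbf{H}=0$ everywhere, and a biminimal submanifold is non-trivial if it is not minimal. *)

(* Defs.v *)
From HB Require Import structures.
From mathcomp Require Import all_boot all_order all_algebra.
From mathcomp Require Import all_classical all_reals all_analysis.

Set Implicit Arguments.
Unset Strict Implicit.
Unset Printing Implicit Defensive.

Import Order.TTheory GRing.Theory Num.Theory.
Import numFieldNormedType.Exports.

Local Open Scope classical_set_scope.
Local Open Scope ring_scope.

(* The library norm on 'rV[R]_m is the sup norm: it is only used for the
   topology and for differentiation. The Euclidean structure is [dot]. *)
Definition dot (R : realType) (m : nat) (v w : 'rV[R]_m) : R :=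
  \sum_(i < m) v 0 i * w 0 i.

Definition enorm (R : realType) (m : nat) (v : 'rV[R]_m) : R :=
  Num.sqrt (dot v v).

Definition round_sphere (R : realType) (n : nat) (r : R) : set 'rV[R]_n.+1 :=
  [set p | enorm p = r].

(* The coordinate vector field d/du_i of R^n. *)
Definition coord_vec (R : realType) (n : nat) (i : 'I_n) : 'rV[R]_n :=
  delta_mx 0 i.

(* f is of class C^k, resp. C^oo, on the open set U; the values of f outside U
   play no role. *)
Fixpoint Ck_on (R : realType) (n m k : nat) (U : set 'rV[R]_n)
    (f : 'rV[R]_n -> 'rV[R]_m) {struct k} : Prop :=
  match k with
  | 0 => forall u, U u -> {for u, continuous f}
  | k'.+1 => (forall u, U u -> differentiable f u) /\
             (forall i : 'I_n, Ck_on k' U ('D_(coord_vec R i) f))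
  end.

Definition smooth_on (R : realType) (n m : nat) (U : set 'rV[R]_n)
    (f : 'rV[R]_n -> 'rV[R]_m) : Prop :=
  forall k, Ck_on k U f.

(* (U, x) is a local parametrization of the n-dimensional subset M of R^m:
   x is a smooth immersion on U and a homeomorphism from U onto an open subset
   of M (last two clauses; W = U gives that x(U) is open in M). *)
Definition local_parametrization (R : realType) (n m : nat) (M : set 'rV[R]_m)
    (U : set 'rV[R]_n) (x : 'rV[R]_n -> 'rV[R]_m) : Prop :=
  [/\ open U,
      smooth_on U x,
      (forall u, U u -> injective ('d x u)),
      (forall u v, U u -> U v -> x u = x v -> u = v) &
      (forall W, open W -> W `<=` U ->
         exists2 V : set 'rV[R]_m, open V & x @` W = M `&` V)].

Definition submanifold (R : realType) (n m : nat) (M : set 'rV[R]_m) : Prop :=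
  forall p, M p ->
    exists (U : set 'rV[R]_n) (x : 'rV[R]_n -> 'rV[R]_m),
      local_parametrization M U x /\ (x @` U) p.

(* Local geometry of an immersed submanifold of Euclidean space R^m, computed
   in a local parametrization x.  A vector field on M is represented by its
   components X : R^n -> R^n in the frame of the partial derivatives of x (the
   corresponding R^m-valued field is [push x X]); a field of ambient vectors
   along M is represented by a map F : R^n -> R^m of the parameter u. *)
Section LocalGeometry.
Context (R : realType) (n m : nat).
Variable x : 'rV[R]_n -> 'rV[R]_m.
Implicit Types (X Y : 'rV[R]_n -> 'rV[R]_n) (F xi : 'rV[R]_n -> 'rV[R]_m).
Implicit Types (u : 'rV[R]_n).

Definition push X : 'rV[R]_n -> 'rV[R]_m := fun u => 'd x u (X u).

Definition induced_metric u (a b : 'rV[R]_n) : R := dot ('d x u a) ('d x u b).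

Definition gram (u : 'rV[R]_n) : 'M[R]_n :=
  \matrix_(i < n, j < n) induced_metric u (coord_vec R i) (coord_vec R j).

(* [christoffel i j k] is Gamma^k_{ij}. *)
Definition christoffel (i j k : 'I_n) (u : 'rV[R]_n) : R :=
  2^-1 * \sum_(l < n) invmx (gram u) k l *
    ('D_(coord_vec R i) (fun v => gram v j l) u
     + 'D_(coord_vec R j) (fun v => gram v i l) u
     - 'D_(coord_vec R l) (fun v => gram v i j) u).

(* Levi-Civita connection of M (nabla), in components. *)
Definition nabla X Y : 'rV[R]_n -> 'rV[R]_n := fun u =>
  'D_(X u) Y u +
  \row_(k < n) \sum_(i < n) \sum_(j < n)
     christoffel i j k u * X u 0 i * Y u 0 j.

(* Levi-Civita connection of R^m (D), acting on ambient fields along M. *)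
Definition ambD X F : 'rV[R]_n -> 'rV[R]_m := fun u => 'D_(X u) F u.

(* D_X Y = nabla_X Y + h(X, Y) *)
Definition second_ff X Y : 'rV[R]_n -> 'rV[R]_m := fun u =>
  ambD X (push Y) u - push (nabla X Y) u.

(* Components a of the vector of T_{x(u)}M which is the orthogonal projection
   of the ambient vector w: sum_i a_i g_{ij} = <w, d_j x> for all j. *)
Definition tangent_part u (w : 'rV[R]_m) : 'rV[R]_n :=
  (\row_(j < n) dot w ('d x u (coord_vec R j))) *m invmx (gram u).

(* D_X xi = - A_xi X + nabla^perp_X xi, the splitting of D_X xi into its
   tangential and normal parts *)
Definition weingarten xi X : 'rV[R]_n -> 'rV[R]_n := fun u =>
  - tangent_part u (ambD X xi u).

Definition nabla_perp X xi : 'rV[R]_n -> 'rV[R]_m := fun u =>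
  ambD X xi u + push (weingarten xi X) u.

Definition orthonormal_frame (U : set 'rV[R]_n)
    (e : 'I_n -> 'rV[R]_n -> 'rV[R]_n) : Prop :=
  (forall i, smooth_on U (e i)) /\
  (forall u, U u -> forall i j, induced_metric u (e i u) (e j u) = (i == j)%:R).

Definition mean_curvature (e : 'I_n -> 'rV[R]_n -> 'rV[R]_n) :
    'rV[R]_n -> 'rV[R]_m := fun u =>
  n%:R^-1 *: \sum_(i < n) second_ff (e i) (e i) u.

Definition normal_laplacian (e : 'I_n -> 'rV[R]_n -> 'rV[R]_n) xi :
    'rV[R]_n -> 'rV[R]_m := fun u =>
  \sum_(i < n) (nabla_perp (e i) (nabla_perp (e i) xi) u
                - nabla_perp (nabla (e i) (e i)) xi u).

End LocalGeometry.

(* The Euler-Lagrange equation of E_2 + lambda E for normal variations. *)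
Definition biminimal (R : realType) (n m : nat) (lambda : R)
    (M : set 'rV[R]_m) : Prop :=
  forall (U : set 'rV[R]_n) (x : 'rV[R]_n -> 'rV[R]_m)
         (e : 'I_n -> 'rV[R]_n -> 'rV[R]_n),
    local_parametrization M U x -> orthonormal_frame x U e ->
    forall u, U u ->
      let H := mean_curvature x e in
      normal_laplacian x e H u
        - \sum_(i < n) second_ff x (weingarten x H (e i)) (e i) u
      = lambda *: H u.

Definition minimal (R : realType) (n m : nat) (M : set 'rV[R]_m) : Prop :=
  forall (U : set 'rV[R]_n) (x : 'rV[R]_n -> 'rV[R]_m)
         (e : 'I_n -> 'rV[R]_n -> 'rV[R]_n),
    local_parametrization M U x -> orthonormal_frame x U e ->
    forall u, U u -> mean_curvature x e u = 0.

Arguments submanifold {R} n {m} M.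
Arguments biminimal {R} n {m} lambda M.
Arguments minimal {R} n {m} M.

(* Main.v *)
Require Import Defs.
From HB Require Import structures.
From mathcomp Require Import all_boot all_order all_algebra.
From mathcomp Require Import all_classical all_reals all_analysis.
From mathcomp Require Import ring.

Set Implicit Arguments.
Unset Strict Implicit.
Unset Printing Implicit Defensive.

Import Order.TTheory GRing.Theory Num.Theory.
Import numFieldNormedType.Exports.

Local Open Scope classical_set_scope.
Local Open Scope ring_scope.

(** Write [S] for the sphere of radius [r] about the origin, [x] for the
position field along [S]. Everything follows from the shape of the second
fundamental form, [h(X, Y) = - <X, Y> / r^2 x]. Tracing it gives
[H = - x / r^2], which does not vanish. Differentiating [H] along [X] gives
[- X / r^2], a tangent vector: hence [A_H = 1 / r^2] is a homothety, [H] is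
parallel in the normal bundle and its normal Laplacian is zero. The
Euler-Lagrange expression is therefore [- (1 / r^2) n H], and
[- n / r^2 = lambda] for [r^2 = n / (- lambda)].

The formula for [h] is obtained in an arbitrary local parametrization [x]
([second_ff_sphere]). In coordinates,
[h(X, Y) = sum_ij X_i Y_j B_ij] with
[B_ij = d_i d_j x - sum_k Gamma^k_ij d_k x] ([second_ffE]).
- [B_ij] is orthogonal to every [d_l x] by Koszul's formula
  ([christoffel_lower]). This step relies on the symmetry of the second
  derivatives of [x]; it is obtained in Young's form ([derive_sym]), from a
  single application of the mean value theorem to a second difference.
- [<B_ij, x> = - g_ij], by differentiating [<x, x> = r^2] twice
  ([dot_x_ddx]).
- The tangent space and [x] together span the ambient space
  ([orth_tangent_position0]), so these products determine [B_ij].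

The stereographic projections from two antipodal points provide local
parametrizations near every point of [S], so that [S] is a submanifold. They
are conformal, hence the coordinate frame, rescaled, is orthonormal. With such a
parametrization and frame at hand, [H = - x / r^2] refutes minimality. *)

(** * Euclidean algebra of row vectors *)

Section DotAlgebra.
Variables (R : realType) (m : nat).
Implicit Types (v w z : 'rV[R]_m) (a : R).

Lemma dotC v w : dot v w = dot w v.
Proof. by apply: eq_bigr => i _; rewrite mulrC. Qed.

Lemma dotDl v w z : dot (v + w) z = dot v z + dot w z.
Proof. by rewrite /dot -big_split; apply: eq_bigr => i _; rewrite mxE mulrDl. Qed.

Lemma dotZl a v w : dot (a *: v) w = a * dot v w.
Proof. by rewrite /dot mulr_sumr; apply: eq_bigr => i _; rewrite mxE mulrA. Qed.

Lemma dotNl v w : dot (- v) w = - dot v w.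
Proof. by rewrite -scaleN1r dotZl mulN1r. Qed.

Lemma dotBl v w z : dot (v - w) z = dot v z - dot w z.
Proof. by rewrite dotDl dotNl. Qed.

Lemma dotZr a v w : dot w (a *: v) = a * dot w v.
Proof. by rewrite dotC dotZl (dotC w). Qed.

Lemma dotBr v w z : dot z (v - w) = dot z v - dot z w.
Proof. by rewrite dotC dotBl !(dotC z). Qed.

Lemma dot0l w : dot 0 w = 0.
Proof. by rewrite /dot big1 // => i _; rewrite mxE mul0r. Qed.

Lemma dot_suml (I : finType) (F : I -> 'rV[R]_m) w :
  dot (\sum_i F i) w = \sum_i dot (F i) w.
Proof.
by apply: (big_morph (fun v => dot v w)) => [v z|]; rewrite ?dotDl ?dot0l.
Qed.

Lemma dot_sumr (I : finType) (F : I -> 'rV[R]_m) w :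
  dot w (\sum_i F i) = \sum_i dot w (F i).
Proof. by rewrite dotC dot_suml; apply: eq_bigr => i _; rewrite dotC. Qed.

Lemma dot_ge0 v : 0 <= dot v v.
Proof. by apply: sumr_ge0 => i _; rewrite -expr2 sqr_ge0. Qed.

Lemma dot_eq0 v : dot v v = 0 -> v = 0.
Proof.
move=> v0; apply/rowP => i; rewrite mxE; apply/eqP; rewrite -sqrf_eq0.
move/eqP: v0; rewrite psumr_eq0 => [|j _]; last by rewrite -expr2 sqr_ge0.
by move=> /allP /(_ i) /=; rewrite mem_index_enum expr2 => /(_ isT).
Qed.

Lemma dot_coord v i : dot v (coord_vec R i) = v 0 i.
Proof.
rewrite /dot (bigD1 i) //= big1 => [|j ji].
  by rewrite !mxE !eqxx mulr1 addr0.
by rewrite !mxE (negPf ji) andbF mulr0.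
Qed.

Lemma row_sum_coord v : v = \sum_(i < m) v 0 i *: coord_vec R i.
Proof. exact: row_sum_delta. Qed.

(** As many orthonormal vectors as the dimension span: the matrix [Q] of these
rows has [Q Q^T = 1], so [Q^T] is invertible. *)
Lemma orthonormal_basis_orth0 (b : 'I_m -> 'rV[R]_m) w :
  (forall i j, dot (b i) (b j) = (i == j)%:R) ->
  (forall i, dot w (b i) = 0) -> w = 0.
Proof.
move=> ob wb; pose Q := \matrix_(i < m, j < m) b i 0 j.
have QQT : Q *m Q^T = 1%:M.
  apply/matrixP => i j; rewrite !mxE -ob; apply: eq_bigr => k _.
  by rewrite !mxE.
have wQ : w *m Q^T = 0.
  apply/rowP => i; rewrite !mxE -[RHS](wb i); apply: eq_bigr => k _.
  by rewrite !mxE.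
by rewrite -[w]mulmx1 -(mulmx1C QQT) mulmxA wQ mul0mx.
Qed.

End DotAlgebra.

(** * Coordinatewise differentiation *)

Section Calculus.
Variable R : realType.

Lemma differentiable_rV (V : normedModType R) m (f : V -> 'rV[R]_m) u :
  (forall j, differentiable (fun v => f v 0 j) u) -> differentiable f u.
Proof.
move=> df; have -> : f = \sum_(j < m) (fun v => f v 0 j *: delta_mx 0 j).
  by apply/funext => v; rewrite fct_sumE; exact: row_sum_delta.
by apply: differentiable_sum => j; apply: differentiableZl.
Qed.

Lemma differentiable_comp_coord (V : normedModType R) m (f : V -> 'rV[R]_m) u j :
  differentiable f u -> differentiable (fun v => f v 0 j) u.
Proof.
move=> df; apply: (@differentiable_comp _ _ _ _ f (fun N : 'rV[R]_m => N 0 j)) => //.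
exact: differentiable_coord.
Qed.

Lemma derive_coord (V : normedModType R) m (f : V -> 'rV[R]_m) u a j :
  derivable f u a -> ('D_a f u) 0 j = 'D_a (fun v => f v 0 j) u.
Proof. by move=> df; rewrite derive_mx // mxE. Qed.

Lemma is_derive_coord (V : normedModType R) m (f : V -> 'rV[R]_m) u a j :
  derivable f u a -> is_derive u a (fun v => f v 0 j) (('D_a f u) 0 j).
Proof.
move=> df; rewrite derive_coord //; apply: derivableP.
exact: ((derivable_mxP _ _ _).1 df 0 j).
Qed.

Lemma is_derive_dot (V : normedModType R) m (f g : V -> 'rV[R]_m) u a :
  derivable f u a -> derivable g u a ->
  is_derive u a (fun v => dot (f v) (g v))
    (dot ('D_a f u) (g u) + dot (f u) ('D_a g u)).
Proof.
move=> df dg.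
have dfj j := is_derive_coord j df.
have dgj j := is_derive_coord j dg.
have -> : (fun v => dot (f v) (g v)) =
    \sum_(j < m) ((fun v => f v 0 j) * (fun v => g v 0 j)).
  by apply/funext => v; rewrite fct_sumE.
apply: is_derive_eq; rewrite /dot -big_split; apply: eq_bigr => j _ /=.
by rewrite [in RHS]addrC; congr (_ + _); exact: mulrC.
Qed.

Lemma derive_sum_coord (W : normedModType R) n (f : 'rV[R]_n -> W) u a :
  differentiable f u -> 'D_a f u = \sum_i a 0 i *: 'D_(coord_vec R i) f u.
Proof.
move=> df; rewrite deriveE // {1}(row_sum_coord a) linear_sum.
by apply: eq_bigr => i _; rewrite linearZ deriveE.
Qed.

End Calculus.

(** * Symmetry of second derivatives *)

Section Young.
Variables (R : realType) (V : normedModType R).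
Implicit Types (f : V -> R) (u a b : V) (t e : R).

Definition second_difference f u a b t : R :=
  f (u + t *: a + t *: b) - f (u + t *: a) - f (u + t *: b) + f u.

Lemma second_differenceC f u a b t :
  second_difference f u a b t = second_difference f u b a t.
Proof. by rewrite /second_difference (addrAC u); ring. Qed.

Lemma is_derive_line f u a t :
  differentiable f (u + t *: a) ->
  is_derive t 1 (fun s => f (u + s *: a)) ('D_a f (u + t *: a)).
Proof.
move=> df.
pose l s : V := u + s *: a.
have dl : is_diff t l ( *:%R ^~ a).
  have -> : l = cst u + *:%R ^~ a by [].
  by apply: is_diff_eq; rewrite add0r.
have dlt : differentiable l t by case: dl.
rewrite -/(l t) in df *; apply: DeriveDef.
  exact/diff_derivable/(differentiable_comp dlt df).
rewrite deriveE; last exact: (differentiable_comp dlt df).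
rewrite diff_comp //= deriveE //.
by have [_ ->] := dl; rewrite scale1r.
Qed.

(** The mean value theorem along [a] turns the second difference into
[t (D_a f (u + c a + t b) - D_a f (u + c a))], and Frechet differentiability of
[D_a f] at [u] evaluates this up to [o(t^2)]. The function [g] stands for
[D_a f] near [u], since differentiability at [u] is a local property. *)
Lemma second_difference_limit f g u a b :
  (\forall v \near u, differentiable f v /\ 'D_a f v = g v) ->
  differentiable g u ->
  forall e, 0 < e -> \forall t \near 0^'+,
    `|second_difference f u a b t - t ^+ 2 * 'D_b g u| <= e * t ^+ 2.
Proof.
move=> df dg e e0.
(* [M] bounds the displacements [c a + t b], [0 <= c <= t], by [t M]; the
   summand 1 keeps it positive. *)
pose M := `|a| + `|b| + 1.
have M0 : 0 < M by rewrite ltr_wpDl // addr_ge0.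
pose d := e / (2 * M).
have d0 : 0 < d by rewrite divr_gt0 // mulr_gt0.
have /eqaddoP /(_ d d0) gP := diff_locally dg.
have fP : \forall h \near (0 : V),
    differentiable f (h + u) /\ 'D_a f (h + u) = g (h + u).
  by move: df; rewrite (near_shift 0) /=; apply: filterS => h; rewrite /= subr0.
have : \forall h \near (0 : V),
    `|g (h + u) - (g u + 'd g u h)| <= d * `|h| /\
    (differentiable f (h + u) /\ 'D_a f (h + u) = g (h + u)).
  by near=> h; split; near: h.
move=> /nbhs_ballP [r /= r0 rP].
have small h : `|h| < r -> `|g (h + u) - (g u + 'd g u h)| <= d * `|h| /\
    (differentiable f (h + u) /\ 'D_a f (h + u) = g (h + u)).
  by move=> hr; apply: rP; rewrite -ball_normE /= sub0r normrN.
near=> t.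
have t0 : 0 < t by near: t; exact: nbhs_right_gt.
have tM : t * M < r.
  by rewrite -ltr_pdivlMr //; near: t; apply: nbhs_right_lt; rewrite divr_gt0.
(* The boolean [k] selects between the points [u + c a + t b] and
   [u + c a]. *)
have bnd c (k : bool) : 0 <= c <= t -> `|c *: a + (k%:R * t) *: b| <= t * M.
  move=> /andP[c0 ct]; rewrite (le_trans (ler_normD _ _)) // !normrZ.
  rewrite (ger0_norm c0) (ger0_norm (ltW t0)) normr_nat.
  apply: (@le_trans _ _ (t * `|a| + t * `|b|)); last first.
    by rewrite -mulrDr ler_pM2l // lerDl.
  rewrite lerD ?ler_wpM2r //; case: k; first by rewrite mul1r.
  by rewrite mul0r ltW.
have bndr c k ct := le_lt_trans (bnd c k ct) tM.
pose F s := f (u + t *: b + s *: a) - f (u + s *: a).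
have dF s : 0 <= s <= t ->
    is_derive s 1 F (g (u + t *: b + s *: a) - g (u + s *: a)).
  move=> st; have [_ [d1 g1]] := small _ (bndr s true st).
  have [_ [d2 g2]] := small _ (bndr s false st).
  rewrite mul1r addrC [s *: a + _]addrC addrA in d1 g1.
  rewrite mul0r scale0r addr0 addrC in d2 g2.
  rewrite -g1 -g2; apply: is_deriveB; [exact: (is_derive_line d1)|exact: (is_derive_line d2)].
have [||c cI Fc] := @MVT R F (fun s => g (u + t *: b + s *: a) - g (u + s *: a))
  0 t t0.
- by move=> s; rewrite in_itv /= => /andP[/ltW s0 /ltW st]; apply: dF; rewrite s0.
- apply: derivable_within_continuous => s; rewrite in_itv /= => st.
  by case: (dF s st).
have ct : 0 <= c <= t.
  by move: cI; rewrite in_itv /= => /andP[/ltW -> /ltW ->].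
have -> : second_difference f u a b t = F t - F 0.
  by rewrite /second_difference /F scale0r !addr0 (addrAC u); ring.
have [g1 _] := small _ (bndr c true ct); have [g2 _] := small _ (bndr c false ct).
have {g1}g1 := le_trans g1 (ler_wpM2l (ltW d0) (bnd c true ct)).
have {g2}g2 := le_trans g2 (ler_wpM2l (ltW d0) (bnd c false ct)).
rewrite mul1r in g1; rewrite mul0r scale0r addr0 in g2.
have dZ k v : 'd g u (k *: v) = k * 'd g u v by exact: linearZ.
have dgE : 'd g u (t *: b + c *: a) = t * 'd g u b + c * 'd g u a.
  by rewrite linearD -!dZ.
rewrite [c *: a + _ + u]addrC [c *: a + _]addrC addrA dgE in g1.
rewrite [c *: a + u]addrC dZ in g2.
rewrite Fc subr0 [X in `|X|](_ : _ = t * (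
   (g (u + t *: b + c *: a) - (g u + (t * 'd g u b + c * 'd g u a)))
   - (g (u + c *: a) - (g u + c * 'd g u a)))); last first.
  by rewrite deriveE //; ring.
rewrite normrM (ger0_norm (ltW t0)) mulrC expr2 mulrA ler_pM2r //.
rewrite (le_trans (ler_normB _ _)) // (le_trans (lerD g1 g2)) //.
rewrite [leLHS](_ : _ = e * t) // /d; field; exact: lt0r_neq0.
Unshelve. all: by end_near. Qed.

(** The second difference is symmetric in [a] and [b] and, divided by [t^2],
tends to either mixed derivative. *)
Lemma derive_sym f g h u a b :
  (\forall v \near u, differentiable f v /\ 'D_a f v = g v) ->
  (\forall v \near u, differentiable f v /\ 'D_b f v = h v) ->
  differentiable g u -> differentiable h u -> 'D_a h u = 'D_b g u.
Proof.
have close (P Q s e t : R) : 0 < t -> `|s - t ^+ 2 * P| <= e * t ^+ 2 ->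
    `|s - t ^+ 2 * Q| <= e * t ^+ 2 -> `|P - Q| <= 2 * e.
  move=> t0 hP hQ; have t2 := exprn_gt0 2 t0; rewrite -(ler_pM2r t2).
  rewrite -[in leLHS](gtr0_norm t2) -normrM.
  have -> : (P - Q) * t ^+ 2 = (s - t ^+ 2 * Q) - (s - t ^+ 2 * P) by ring.
  rewrite (le_trans (ler_normB _ _)) // (le_trans (lerD hQ hP)) //.
  by rewrite -mulrDl -mulr2n mulr_natl.
move=> fg fh dg dh; apply/eqP; rewrite -subr_eq0 -normr_eq0 eq_le normr_ge0 andbT.
apply/ler_addgt0Pr => e e0; rewrite add0r.
have e20 : 0 < e / 2 by rewrite divr_gt0.
have lim_ab := second_difference_limit b fg dg e20.
have lim_ba := second_difference_limit a fh dh e20.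
have [t [h1 h2 t0]] : exists t, [/\
    `|second_difference f u a b t - t ^+ 2 * 'D_b g u| <= e / 2 * t ^+ 2,
    `|second_difference f u b a t - t ^+ 2 * 'D_a h u| <= e / 2 * t ^+ 2 &
    0 < t].
  apply: (@filter_ex _ (0 : R)^'+).
  exact: filterS3 (fun t => @And3 _ _ _) lim_ab lim_ba (nbhs_right_gt (0 : R)).
rewrite second_differenceC in h2.
by have := close _ _ _ _ _ t0 h2 h1; rewrite mulrC divfK.
Qed.

End Young.

(* From here on derivatives are handled through their calculus only. *)
Local Opaque derive.

(** * The second fundamental form in coordinates *)

Section TangentialPart.
Variables (R : realType) (n m : nat) (U : set 'rV[R]_n).
Variable x : 'rV[R]_n -> 'rV[R]_m.
Hypotheses (openU : open U) (C2x : Ck_on 2 U x).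
Implicit Types (u v a : 'rV[R]_n) (i j k l : 'I_n).

Local Notation dx i := ('D_(coord_vec R i) x).
Local Notation ddx i j := ('D_(coord_vec R i) (dx j)).

Lemma near_open u : U u -> \forall v \near u, U v.
Proof. by move=> Uu; apply: open_nbhs_nbhs; split. Qed.

Lemma differentiable_param u : U u -> differentiable x u.
Proof. exact: C2x.1. Qed.

Lemma differentiable_partial u i : U u -> differentiable (dx i) u.
Proof. exact: (C2x.2 i).1. Qed.

Lemma derivable_param u a : U u -> derivable x u a.
Proof. by move=> Uu; apply/diff_derivable/differentiable_param. Qed.

Lemma derivable_partial u i a : U u -> derivable (dx i) u a.
Proof. by move=> Uu; apply/diff_derivable/differentiable_partial. Qed.

Lemma diff_coord_vec u i : U u -> 'd x u (coord_vec R i) = dx i u.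
Proof. by move=> Uu; rewrite -deriveE //; exact: differentiable_param. Qed.

Lemma diff_sum_coord u a : U u -> 'd x u a = \sum_i a 0 i *: dx i u.
Proof.
by move=> Uu; rewrite -deriveE ?derive_sum_coord //; exact: differentiable_param.
Qed.

Lemma gramE u i j : U u -> gram x u i j = dot (dx i u) (dx j u).
Proof. by move=> Uu; rewrite mxE /induced_metric !diff_coord_vec. Qed.

Lemma gramC u i j : gram x u i j = gram x u j i.
Proof. by rewrite !mxE /induced_metric dotC. Qed.

Lemma induced_metricE u a b :
  induced_metric x u a b = \sum_i \sum_j a 0 i * b 0 j * gram x u i j.
Proof.
rewrite /induced_metric {1}(row_sum_coord a) {1}(row_sum_coord b) !linear_sum.
rewrite dot_suml; apply: eq_bigr => i _; rewrite dot_sumr.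
apply: eq_bigr => j _; rewrite !linearZ dotZl dotZr mxE /induced_metric mulrA //.
Qed.

(** Young's theorem, one ambient coordinate at a time. *)
Lemma second_partialC u i j : U u -> ddx i j u = ddx j i u.
Proof.
move=> Uu; apply/rowP => k; pose xk v := x v 0 k.
have xkP p : \forall v \near u, differentiable xk v /\
    'D_(coord_vec R p) xk v = 'D_(coord_vec R p) x v 0 k.
  near=> v; have Uv : U v by near: v; exact: near_open.
  split; first exact/differentiable_comp_coord/differentiable_param.
  by apply/esym/derive_coord/derivable_param.
have ddxk p q : ddx p q u 0 k = 'D_(coord_vec R p) (fun v => dx q v 0 k) u.
  by apply: derive_coord; exact: derivable_partial.
have dxk p : differentiable (fun v => dx p v 0 k) u.
  by apply: differentiable_comp_coord; exact: differentiable_partial.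
apply: (etrans (ddxk i j)); apply: (etrans _ (esym (ddxk j i))).
exact: (derive_sym (xkP i) (xkP j) (dxk i) (dxk j)).
Unshelve. all: by end_near. Qed.

Lemma derive_gram u l i j : U u ->
  'D_(coord_vec R l) (fun v => gram x v i j) u =
  dot (ddx l i u) (dx j u) + dot (dx i u) (ddx l j u).
Proof.
move=> Uu; rewrite (@near_eq_derive _ _ _ _ (fun v => dot (dx i v) (dx j v))).
  by case: (is_derive_dot (@derivable_partial u i (coord_vec R l) Uu)
                          (@derivable_partial u j (coord_vec R l) Uu)).
by near=> v; apply: gramE; near: v; exact: near_open.
Unshelve. all: by end_near. Qed.

(** Koszul's formula: by symmetry of the second derivatives the three
derivatives of the metric add up to twice [<d_i d_j x, d_l x>]. *)
Lemma christoffel_lower u i j l : U u -> gram x u \in unitmx ->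
  \sum_k christoffel x i j k u * gram x u k l = dot (ddx i j u) (dx l u).
Proof.
move=> Uu Gu.
(* Past [dgE], only linear algebra in the vectors [D p] and [A p q] is left. *)
have [D DE] : exists D, forall p, dx p u = D p by exists (fun p => dx p u).
have [A AE] : exists A, forall p q, ddx p q u = A p q.
  by exists (fun p q => ddx p q u).
have AC p q : A p q = A q p by rewrite -!AE; exact: second_partialC.
pose dg p q s := dot (A p q) (D s) + dot (D q) (A p s).
have dgE p q s : 'D_(coord_vec R p) (fun v => gram x v q s) u = dg p q s.
  by rewrite /dg -!AE -!DE; exact: derive_gram.
pose c : 'cV[R]_n := \col_p (dg i j p + dg j i p - dg p i j).
have cE k : christoffel x i j k u = 2^-1 * (invmx (gram x u) *m c) k 0.
  rewrite /christoffel [in RHS]mxE; congr (_ * _).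
  apply: eq_bigr => p _; rewrite [c _ _]mxE.
  by congr (_ * (_ + _ - _)); exact: dgE.
transitivity (2^-1 * (gram x u *m (invmx (gram x u) *m c)) l 0).
  rewrite mxE mulr_sumr; apply: eq_bigr => k _.
  by rewrite cE (gramC u k) -mulrA [X in _ * X]mulrC.
rewrite AE DE mulKVmx // mxE /dg (AC j i) (AC l i) (AC l j) !(dotC (D _)).
by field.
Qed.

(** The vectors [h(d_i, d_j)] on coordinate fields, which determine [h] because
it is tensorial. *)
Definition second_ff_coef u i j : 'rV[R]_m :=
  ddx i j u - \sum_k christoffel x i j k u *: dx k u.

(** Gauss' formula: the Christoffel symbols remove exactly the tangential part
of [d_i d_j x]. *)
Lemma second_ff_coef_normal u i j l : U u -> gram x u \in unitmx ->
  dot (second_ff_coef u i j) (dx l u) = 0.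
Proof.
move=> Uu Gu; rewrite dotBl dot_suml -christoffel_lower //.
apply/eqP; rewrite subr_eq0; apply/eqP; apply: eq_bigr => k _.
by rewrite dotZl gramE.
Qed.

Lemma derive_push u a (Y : 'rV[R]_n -> 'rV[R]_n) : U u ->
  differentiable Y u ->
  'D_a (push x Y) u = 'd x u ('D_a Y u) + \sum_j Y u 0 j *: 'D_a (dx j) u.
Proof.
move=> Uu dY.
have dYj j : is_derive u a (fun v => Y v 0 j) ('D_a Y u 0 j).
  exact/is_derive_coord/diff_derivable.
have ddxk j (k : 'I_m) : is_derive u a (fun v => dx j v 0 k) ('D_a (dx j) u 0 k).
  exact/is_derive_coord/derivable_partial.
have dpush (k : 'I_m) : is_derive u a (fun v => push x Y v 0 k)
    (\sum_j (Y u 0 j *: 'D_a (dx j) u 0 k + dx j u 0 k *: 'D_a Y u 0 j)).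
  have pushE : \forall v \near u,
      (\sum_j (fun v => Y v 0 j) * (fun v => dx j v 0 k)) v = push x Y v 0 k.
    near=> v; have Uv : U v by near: v; exact: near_open.
    rewrite /push diff_sum_coord // summxE fct_sumE; apply: eq_bigr => j _.
    by rewrite [in RHS]mxE.
  apply: (near_eq_is_derive pushE); apply: is_derive_sum => j.
  exact: (is_deriveM (dYj j) (ddxk j k)).
apply/rowP => k; rewrite derive_coord; last first.
  by apply/derivable_mxP => i0 k'; rewrite (ord1 i0); case: (dpush k').
have [_ ->] := dpush k; rewrite big_split addrC diff_sum_coord // mxE !summxE.
by congr (_ + _); apply: eq_bigr => j _; rewrite [in RHS]mxE //; exact: mulrC.
Unshelve. all: by end_near. Qed.

(** The derivatives of the components of [Y] cancel between the ambient and the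
Levi-Civita derivatives. *)
Lemma second_ffE u (X Y : 'rV[R]_n -> 'rV[R]_n) : U u -> differentiable Y u ->
  second_ff x X Y u =
  \sum_i \sum_j (X u 0 i * Y u 0 j) *: second_ff_coef u i j.
Proof.
move=> Uu dY; rewrite /second_ff /ambD derive_push // /push /nabla linearD /=.
rewrite opprD addrACA subrr add0r (diff_sum_coord _ Uu).
pose G k : R := \sum_i \sum_j christoffel x i j k u * X u 0 i * Y u 0 j.
transitivity (\sum_j (\sum_i (X u 0 i * Y u 0 j) *: ddx i j u) -
    \sum_k G k *: dx k u).
  congr (_ - _); last by apply: eq_bigr => k _; rewrite mxE.
  apply: eq_bigr => j _; rewrite derive_sum_coord; last exact: differentiable_partial.
  by rewrite scaler_sumr; apply: eq_bigr => i _; rewrite scalerA mulrC.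
rewrite exchange_big /=.
transitivity (\sum_i \sum_j (X u 0 i * Y u 0 j) *: ddx i j u -
  \sum_i \sum_j (X u 0 i * Y u 0 j) *: \sum_k christoffel x i j k u *: dx k u).
  congr (_ - _).
  under [RHS]eq_bigr do under eq_bigr do rewrite scaler_sumr.
  under [RHS]eq_bigr do rewrite exchange_big.
  rewrite [RHS]exchange_big; apply: eq_bigr => k _; rewrite scaler_suml.
  apply: eq_bigr => i _; rewrite scaler_suml; apply: eq_bigr => j _.
  by rewrite scalerA -mulrA mulrC.
rewrite -sumrB; apply: eq_bigr => i _; rewrite -sumrB; apply: eq_bigr => j _.
by rewrite scalerBr.
Qed.

End TangentialPart.

(** * Hypersurfaces in a round sphere *)

Section SphericalPatch.
Variables (R : realType) (n : nat) (U : set 'rV[R]_n) (r : R).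
Variable x : 'rV[R]_n -> 'rV[R]_n.+1.
Variable e : 'I_n -> 'rV[R]_n -> 'rV[R]_n.
Hypotheses (openU : open U) (C2x : Ck_on 2 U x) (r_gt0 : 0 < r).
Hypothesis x_sphere : forall u, U u -> dot (x u) (x u) = r ^+ 2.
Hypothesis frame_e : orthonormal_frame x U e.
Implicit Types (u v a : 'rV[R]_n) (i j k l : 'I_n).

Local Notation dx i := ('D_(coord_vec R i) x).
Local Notation ddx i j := ('D_(coord_vec R i) (dx j)).

Lemma frame_metric u i j :
  U u -> induced_metric x u (e i u) (e j u) = (i == j)%:R.
Proof. by case: frame_e => _ eP Uu; exact: eP. Qed.

Lemma frame_diff u i : U u -> differentiable (e i) u.
Proof. by case: frame_e => eC _; exact: (eC i 1%N).1. Qed.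

Lemma dot_x_dx u i : U u -> dot (x u) (dx i u) = 0.
Proof.
move=> Uu; have dxu : derivable x u (coord_vec R i) by apply: (derivable_param C2x).
have [_] := is_derive_dot dxu dxu.
rewrite (@near_eq_derive _ _ _ _ (cst (r ^+ 2))); last first.
  by near=> v; apply: x_sphere; near: v; exact: near_open.
rewrite derive_cst [X in X + _]dotC -mulr2n => /esym/eqP.
by rewrite mulrn_eq0 => /eqP.
Unshelve. all: by end_near. Qed.

Lemma dot_x_ddx u i j : U u -> dot (x u) (ddx i j u) = - gram x u i j.
Proof.
move=> Uu; have dxu : derivable x u (coord_vec R i) by apply: (derivable_param C2x).
have ddxu : derivable (dx j) u (coord_vec R i) by apply: (derivable_partial C2x).
have [_] := is_derive_dot dxu ddxu.
rewrite (@near_eq_derive _ _ _ _ (cst 0)); last first.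
  by near=> v; apply: dot_x_dx; near: v; exact: near_open.
rewrite derive_cst (gramE C2x) // => /esym/eqP.
by rewrite addrC addr_eq0 => /eqP.
Unshelve. all: by end_near. Qed.

(** If the rows of [E] are the frame and [G] is the Gram matrix, then
[E G E^T = 1]. *)
Lemma gram_unit u : U u -> gram x u \in unitmx.
Proof.
move=> Uu; pose E : 'M[R]_n := \matrix_(i, j) e i u 0 j.
have EGE : E *m (gram x u *m E^T) = 1%:M.
  apply/matrixP => i j; rewrite !mxE -(frame_metric i j Uu) induced_metricE.
  apply: eq_bigr => k _; rewrite !mxE mulr_sumr; apply: eq_bigr => l _.
  by rewrite !mxE mulrA mulrAC.
by have [_] := mulmx1_unit EGE; rewrite unitmx_mul => /andP[].
Qed.

(** The frame, pushed forward, and [x / r] form an orthonormal basis of the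
ambient space. *)
Lemma orth_tangent_position0 u (w : 'rV[R]_n.+1) : U u ->
  dot w (x u) = 0 -> (forall l, dot w (dx l u) = 0) -> w = 0.
Proof.
move=> Uu wx wdx.
pose b (i : 'I_n.+1) : 'rV[R]_n.+1 :=
  if unlift ord0 i is Some l then 'd x u (e l u) else r^-1 *: x u.
have xd a : dot (x u) ('d x u a) = 0.
  rewrite (diff_sum_coord C2x) // dot_sumr big1 // => i _.
  by rewrite dotZr dot_x_dx // mulr0.
apply: (@orthonormal_basis_orth0 _ _ b) => [i j|i]; rewrite /b.
  case: (unliftP ord0 i) => [k|] ->; case: (unliftP ord0 j) => [l|] -> //.
  - by rewrite (inj_eq lift_inj) -(frame_metric k l Uu).
  - by rewrite dotZr dotC xd mulr0 eq_sym.
  - by rewrite dotZl xd mulr0.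
  - by rewrite dotZl dotZr x_sphere // eqxx /=; field; exact: lt0r_neq0.
case: unliftP => [k|] _; last by rewrite dotZr wx mulr0.
rewrite (diff_sum_coord C2x) // dot_sumr big1 // => l _.
by rewrite dotZr wdx mulr0.
Qed.

(** Both sides have the same products with [x] and with every [d_l x]. *)
Lemma second_ff_coef_sphere u i j : U u ->
  second_ff_coef x u i j = (- gram x u i j / r ^+ 2) *: x u.
Proof.
move=> Uu; apply/eqP; rewrite -subr_eq0; apply/eqP.
apply: (orth_tangent_position0 Uu) => [|l]; rewrite dotBl dotZl.
  rewrite x_sphere // dotBl dotC dot_x_ddx // dot_suml big1; last first.
    by move=> k _; rewrite dotZl dotC dot_x_dx // mulr0.
  by field; exact: lt0r_neq0.
by rewrite (second_ff_coef_normal openU C2x) ?gram_unit // dot_x_dx // mulr0 subr0.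
Qed.

Lemma second_ff_sphere u (X Y : 'rV[R]_n -> 'rV[R]_n) :
  U u -> differentiable Y u ->
  second_ff x X Y u = (- induced_metric x u (X u) (Y u) / r ^+ 2) *: x u.
Proof.
move=> Uu dY; rewrite (second_ffE openU C2x) //.
rewrite induced_metricE mulNr mulr_suml scaleNr scaler_suml -sumrN.
apply: eq_bigr => i _; rewrite mulr_suml scaler_suml -sumrN.
apply: eq_bigr => j _; rewrite second_ff_coef_sphere // scalerA -scaleNr.
by congr (_ *: _); rewrite !mulNr mulrN mulrA.
Qed.

Lemma mean_curvature_sphere u : (0 < n)%N -> U u ->
  mean_curvature x e u = (- r ^- 2) *: x u.
Proof.
move=> n_gt0 Uu; rewrite /mean_curvature.
under eq_bigr => i _.
  rewrite second_ff_sphere //; last exact: frame_diff.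
  rewrite frame_metric // eqxx mulN1r.
  over.
rewrite sumr_const card_ord -[X in _ *: X]scaler_nat scalerA.
by rewrite mulVf ?scale1r // pnatr_eq0 -lt0n.
Qed.

Lemma tangent_part_diff u a : U u -> tangent_part x u ('d x u a) = a.
Proof.
move=> Uu; rewrite /tangent_part.
have -> : \row_j dot ('d x u a) ('d x u (coord_vec R j)) = a *m gram x u.
  apply/rowP => j; rewrite !mxE {1}(row_sum_coord a) linear_sum dot_suml.
  by apply: eq_bigr => i _; rewrite linearZ dotZl mxE.
by rewrite mulmxK ?gram_unit.
Qed.

(** Constant multiples of the position field, such as the mean curvature vector
([c = - r^-2]) and the zero field ([c = 0]), are parallel in the normal bundle,
and their Weingarten map is a homothety. *)
Section PositionField.
Variables (c : R) (xi : 'rV[R]_n -> 'rV[R]_n.+1).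
Hypothesis xiE : forall u, U u -> xi u = c *: x u.

Lemma ambD_position u X : U u -> ambD X xi u = c *: 'd x u (X u).
Proof.
move=> Uu; rewrite /ambD (@near_eq_derive _ _ _ _ (c *: x)); last first.
  by near=> v; apply: xiE; near: v; exact: near_open.
have dxu : derivable x u (X u) by apply: (derivable_param C2x).
by rewrite (deriveZ c dxu) deriveE //; apply: (differentiable_param C2x).
Unshelve. all: by end_near. Qed.

Lemma weingarten_position u X : U u -> weingarten x xi X u = (- c) *: X u.
Proof.
by move=> Uu; rewrite /weingarten ambD_position // -linearZ tangent_part_diff //
  scaleNr.
Qed.

Lemma nabla_perp_position u X : U u -> nabla_perp x X xi u = 0.
Proof.
move=> Uu; rewrite /nabla_perp ambD_position // /push weingarten_position //.
by rewrite linearZ /= scaleNr subrr.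
Qed.

End PositionField.

(** The Laplacian of the parallel field [H] vanishes, and [A_H = r^-2] turns the
remaining sum into [r^-2 n H]. *)
Lemma biminimal_sphere_patch u : (0 < n)%N -> U u ->
  let H := mean_curvature x e in
  normal_laplacian x e H u
    - \sum_(i < n) second_ff x (weingarten x H (e i)) (e i) u
  = (- n%:R / r ^+ 2) *: H u.
Proof.
move=> n_gt0 Uu H.
have HE v : U v -> H v = (- r ^- 2) *: x v by exact: mean_curvature_sphere.
have perp0 X v : U v -> nabla_perp x X H v = 0 *: x v.
  by move=> Uv; rewrite (nabla_perp_position HE) // scale0r.
rewrite /normal_laplacian big1 => [|i _]; last first.
  by rewrite perp0 // (nabla_perp_position (perp0 _)) // scale0r subrr.
rewrite sub0r.
under eq_bigr => i _.
  rewrite second_ff_sphere //; last exact: frame_diff.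
  rewrite (weingarten_position HE) // opprK /induced_metric linearZ dotZl.
  rewrite -/(induced_metric x u (e i u) (e i u)) frame_metric // eqxx mulr1.
  over.
rewrite sumr_const card_ord HE // -[X in - X]scaler_nat !scalerA -scaleNr.
by congr (_ *: _); field; exact: lt0r_neq0.
Qed.

End SphericalPatch.

(** * Smoothness of rational maps with denominators [1 + |u|^2] *)

Section StereographicAlgebra.
Variables (R : realType) (n : nat).
Implicit Types (f g : 'rV[R]_n -> R) (u v a : 'rV[R]_n) (i : 'I_n).

(** Up to the factor [2 r], the conformal factor of stereographic projection. *)
Definition conf (u : 'rV[R]_n) : R := (1 + dot u u)^-1.

Lemma conf_den_gt0 u : 0 < 1 + dot u u.
Proof. by rewrite ltr_wpDr // dot_ge0. Qed.

Lemma conf_gt0 u : 0 < conf u.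
Proof. by rewrite invr_gt0 conf_den_gt0. Qed.

Lemma confE u : conf u * (1 + dot u u) = 1.
Proof. by rewrite mulVf // lt0r_neq0 // conf_den_gt0. Qed.

(** The algebra of functions generated by the coordinates and [conf]. It is
closed under partial derivatives, so its members have derivatives of all
orders. *)
Inductive coord_conf_alg : ('rV[R]_n -> R) -> Prop :=
| alg_cst c : coord_conf_alg (cst c)
| alg_coord i : coord_conf_alg (fun u => u 0 i)
| alg_conf : coord_conf_alg conf
| alg_add f g : coord_conf_alg f -> coord_conf_alg g -> coord_conf_alg (f + g)
| alg_mul f g : coord_conf_alg f -> coord_conf_alg g -> coord_conf_alg (f * g).

Lemma alg_sum (f : 'I_n -> 'rV[R]_n -> R) :
  (forall i, coord_conf_alg (f i)) -> coord_conf_alg (\sum_i f i).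
Proof.
by move=> fP; elim/big_ind: _ => //; [exact: (alg_cst 0)|exact: alg_add].
Qed.

Lemma sqnormE : (fun u => dot u u) = \sum_i (fun u : 'rV[R]_n => u 0 i) ^+ 2.
Proof.
by apply/funext => u; rewrite fct_sumE; apply: eq_bigr => i _; rewrite -expr2.
Qed.

Lemma differentiable_sqnorm u : differentiable (fun v => dot v v : R) u.
Proof.
rewrite sqnormE; apply: differentiable_sum => i.
by apply: differentiableX; exact: differentiable_coord.
Qed.

Lemma is_derive_sqnorm u a : is_derive u a (fun v => dot v v : R) (2 * dot u a).
Proof.
have did : derivable (@idfun 'rV[R]_n) u a by exact: derivable_id.
have [d1 d2] := is_derive_dot did did.
split => //; rewrite d2 derive_id [X in X + _]dotC; ring.
Qed.

Lemma differentiable_conf u : differentiable conf u.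
Proof.
have dden : differentiable (cst 1 + (fun v : 'rV[R]_n => dot v v)) u.
  by apply: differentiableD; [exact: differentiable_cst|exact: differentiable_sqnorm].
by apply: (differentiableV dden); rewrite lt0r_neq0 // conf_den_gt0.
Qed.

Lemma is_derive_conf u a :
  is_derive u a conf (- 2 * dot u a * conf u ^+ 2).
Proof.
split; first exact/diff_derivable/differentiable_conf.
have dden := is_deriveD (is_derive_cst (1 : R) u a) (is_derive_sqnorm u a).
have [d1 d2] := dden.
rewrite /conf deriveV //; last by rewrite lt0r_neq0 // conf_den_gt0.
by rewrite d2 add0r exprVn /GRing.scale /=; ring.
Qed.

Lemma is_derive_proj u a i : is_derive u a (fun v => v 0 i) (a 0 i).
Proof.
have did : derivable (@idfun 'rV[R]_n) u a by exact: derivable_id.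
by have := is_derive_coord i did; rewrite derive_id.
Qed.

(** The partial derivatives of a coordinate are constant, and those of [conf]
are [- 2 u_i conf^2]. *)
Lemma alg_derive f : coord_conf_alg f ->
  (forall u, differentiable f u) /\
  (forall i, coord_conf_alg ('D_(coord_vec R i) f)).
Proof.
elim=> {f} [c|j||f g _ [df Df] _ [dg Dg]|f g fA [df Df] gA [dg Dg]].
- split=> [u|i]; first exact: differentiable_cst.
  rewrite (_ : 'D__ _ = cst 0); first exact: alg_cst.
  by apply/funext => u; exact: derive_cst.
- split=> [u|i]; first exact: differentiable_coord.
  rewrite (_ : 'D__ _ = cst (coord_vec R i 0 j)); first exact: alg_cst.
  by apply/funext => u; case: (is_derive_proj u (coord_vec R i) j).
- split=> [u|i]; first exact: differentiable_conf.
  rewrite (_ : 'D__ _ = cst (- 2) * (fun u => u 0 i) * (conf * conf)).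
    by do ?apply: alg_mul; constructor.
  apply/funext => u; have [_ ->] := is_derive_conf u (coord_vec R i).
  by rewrite dot_coord.
- split=> [u|i]; first exact: differentiableD.
  rewrite (_ : 'D__ _ = 'D_(coord_vec R i) f + 'D_(coord_vec R i) g).
    exact: alg_add.
  by apply/funext => u; apply: deriveD; exact: diff_derivable.
- split=> [u|i]; first exact: differentiableM.
  rewrite (_ : 'D__ _ = f * 'D_(coord_vec R i) g + g * 'D_(coord_vec R i) f).
    by apply: alg_add; apply: alg_mul.
  by apply/funext => u; apply: deriveM; exact: diff_derivable.
Qed.

Lemma alg_smooth m (f : 'rV[R]_n -> 'rV[R]_m) :
  (forall j, coord_conf_alg (fun u => f u 0 j)) -> smooth_on setT f.
Proof.
have diff_f (h : 'rV[R]_n -> 'rV[R]_m) :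
    (forall j, coord_conf_alg (fun u => h u 0 j)) -> forall u, differentiable h u.
  move=> hA u; apply: differentiable_rV => j; exact: (alg_derive (hA j)).1.
move=> fA k; elim: k f fA => [|k IHk] f fA.
  by move=> u _; apply: differentiable_continuous; exact: diff_f.
split=> [u _|i]; first exact: diff_f.
apply: IHk => j.
rewrite (_ : (fun _ => _) = 'D_(coord_vec R i) (fun v => f v 0 j)).
  exact: (alg_derive (fA j)).2.
by apply/funext => u; apply: derive_coord; apply/diff_derivable/diff_f.
Qed.

End StereographicAlgebra.

(** * Stereographic parametrizations *)

Lemma dot_recl (R : realType) n (v w : 'rV[R]_n.+1) :
  dot v w = v 0 ord0 * w 0 ord0
            + \sum_(i < n) v 0 (lift ord0 i) * w 0 (lift ord0 i).
Proof. exact: big_ord_recl. Qed.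

Lemma round_sphereP (R : realType) n (r : R) (p : 'rV[R]_n.+1) :
  0 <= r -> round_sphere r p <-> dot p p = r ^+ 2.
Proof.
move=> r0; rewrite /round_sphere /enorm /=; split=> [<-|->].
  by rewrite sqr_sqrtr // dot_ge0.
by rewrite sqrtr_sqr ger0_norm.
Qed.

Section Stereographic.
Variables (R : realType) (n : nat) (r s : R).
Hypotheses (r_gt0 : 0 < r) (s_sign : s * s = 1).
Implicit Types (u v a b : 'rV[R]_n) (p : 'rV[R]_n.+1) (i : 'I_n).

Local Notation q := (@conf R n).

(** Inverse stereographic projection from the pole [- s r] on the axis of index
[ord0], where [s] is 1 or -1; the remaining axes are those of the parameter. *)
Definition stereo u : 'rV[R]_n.+1 := \row_j
  (if unlift ord0 j is Some i then 2 * r * q u * u 0 i else s * r * (2 * q u - 1)).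

Definition unstereo p : 'rV[R]_n :=
  \row_i (p 0 (lift ord0 i) / (s * p 0 ord0 + r)).

Lemma stereo0 u : stereo u 0 ord0 = s * r * (2 * q u - 1).
Proof. by rewrite mxE unlift_none. Qed.

Lemma stereoS u i : stereo u 0 (lift ord0 i) = 2 * r * q u * u 0 i.
Proof. by rewrite mxE liftK. Qed.

Lemma stereo_sphere u : dot (stereo u) (stereo u) = r ^+ 2.
Proof.
rewrite dot_recl stereo0.
have -> : \sum_i stereo u 0 (lift ord0 i) * stereo u 0 (lift ord0 i) =
    4 * r ^+ 2 * q u ^+ 2 * dot u u.
  by rewrite /dot mulr_sumr; apply: eq_bigr => i _; rewrite stereoS; ring.
have h := confE u; transitivity (r ^+ 2 * ((s * s) * (2 * q u - 1) ^+ 2 +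
  4 * q u * (q u * (1 + dot u u) - q u))); first by ring.
by rewrite h s_sign; ring.
Qed.

Lemma stereo_smooth : smooth_on setT stereo.
Proof.
apply: alg_smooth => j; case: (unliftP ord0 j) => [i|] ->.
  rewrite (_ : (fun _ => _) = cst (2 * r) * @conf R n * (fun u => u 0 i)).
    by do ?apply: alg_mul; constructor.
  by apply/funext => u; rewrite stereoS.
rewrite (_ : (fun _ => _) = cst (s * r) * (cst 2 * @conf R n + cst (- 1))).
  by do ?[apply: alg_mul|apply: alg_add]; constructor.
by apply/funext => u; rewrite stereo0.
Qed.

Lemma differentiable_stereo u : differentiable stereo u.
Proof. exact: (stereo_smooth 1%N).1. Qed.

Lemma diff_stereo_coord u a j :
  ('d stereo u a) 0 j = 'D_a (fun v => stereo v 0 j) u.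
Proof.
rewrite -deriveE; last exact: differentiable_stereo.
by apply: derive_coord; apply/diff_derivable/differentiable_stereo.
Qed.

Lemma diff_stereo0 u a :
  ('d stereo u a) 0 ord0 = - 4 * s * r * q u ^+ 2 * dot u a.
Proof.
rewrite diff_stereo_coord.
have -> : (fun v => stereo v 0 ord0) = (2 * s * r) \*: q + cst (- (s * r)).
  by apply/funext => v; rewrite stereo0 -[RHS]/(2 * s * r * q v - s * r); ring.
have [_ ->] := is_deriveD (is_deriveZ (2 * s * r) (is_derive_conf u a))
  (is_derive_cst (- (s * r)) u a).
by rewrite addr0 /GRing.scale /=; ring.
Qed.

Lemma diff_stereoS u a i : ('d stereo u a) 0 (lift ord0 i) =
  2 * r * q u * (a 0 i - 2 * q u * dot u a * u 0 i).
Proof.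
rewrite diff_stereo_coord.
have -> : (fun v => stereo v 0 (lift ord0 i)) =
    (2 * r) \*: (q * (fun v => v 0 i)).
  by apply/funext => v; rewrite stereoS -mulrA.
have [_ ->] := is_deriveZ (2 * r) (is_deriveM (is_derive_conf u a)
  (is_derive_proj u a i)).
by rewrite /GRing.scale /=; ring.
Qed.

(** Conformality: the metric is a multiple of the Euclidean one, because
[q (1 + |u|^2) = 1] cancels the terms in [<u, a> <u, b>]. *)
Lemma stereo_metric u a b :
  induced_metric stereo u a b = 4 * r ^+ 2 * q u ^+ 2 * dot a b.
Proof.
rewrite /induced_metric dot_recl !diff_stereo0.
have -> : \sum_i ('d stereo u a) 0 (lift ord0 i) * ('d stereo u b) 0 (lift ord0 i)
  = 4 * r ^+ 2 * q u ^+ 2 * (dot a b - 4 * q u * dot u a * dot u b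
    + 4 * q u ^+ 2 * dot u a * dot u b * dot u u).
  transitivity (4 * r ^+ 2 * q u ^+ 2 * dot (a - (2 * q u * dot u a) *: u)
                                           (b - (2 * q u * dot u b) *: u)).
    rewrite [dot (a - _) _]/dot mulr_sumr; apply: eq_bigr => i _.
    by rewrite !diff_stereoS !mxE; ring.
  by rewrite !dotBl !dotBr !dotZl !dotZr (dotC a u); ring.
have h := confE u.
transitivity (4 * r ^+ 2 * q u ^+ 2 * (dot a b + 4 * q u * dot u a * dot u b *
  ((s * s) * q u - 1 + (q u * (1 + dot u u) - q u)))); first by ring.
by rewrite h s_sign; ring.
Qed.

Lemma stereoK : cancel stereo unstereo.
Proof.
move=> u; apply/rowP => i; rewrite mxE stereoS stereo0.
have q0 := conf_gt0 u.
have -> : s * (s * r * (2 * q u - 1)) + r = 2 * r * q u.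
  by rewrite mulrA mulrA s_sign; ring.
by field; rewrite !lt0r_neq0.
Qed.

(** On the sphere, [1 + |unstereo p|^2 = 2 r / (s p_0 + r)]. *)
Lemma unstereoK p : dot p p = r ^+ 2 -> s * p 0 ord0 + r != 0 ->
  stereo (unstereo p) = p.
Proof.
move=> pS d0; set d := s * p 0 ord0 + r in d0 *.
have uu : 1 + dot (unstereo p) (unstereo p) = 2 * r / d.
  have -> : dot (unstereo p) (unstereo p) = (r ^+ 2 - p 0 ord0 ^+ 2) / d ^+ 2.
    rewrite -pS dot_recl -expr2 addrAC subrr add0r mulr_suml.
    by apply: eq_bigr => i _; rewrite mxE -/d; field.
  have -> : p 0 ord0 ^+ 2 = (d - r) ^+ 2.
    by rewrite /d addrK exprMn [s ^+ 2]expr2 s_sign mul1r.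
  by field.
have qE : q (unstereo p) = d / (2 * r) by rewrite /conf uu invf_div.
apply/rowP => j; case: (unliftP ord0 j) => [i|] ->.
  rewrite stereoS qE mxE -/d; field.
  by rewrite d0 lt0r_neq0.
rewrite stereo0 qE.
have -> : 2 * (d / (2 * r)) - 1 = s * p 0 ord0 / r.
  by rewrite /d; field; rewrite lt0r_neq0.
rewrite -[RHS]mul1r -s_sign; field; rewrite lt0r_neq0 //.
Qed.

Lemma differentiable_unstereo p : s * p 0 ord0 + r != 0 ->
  differentiable unstereo p.
Proof.
move=> d0; apply: differentiable_rV => i.
have dd : differentiable ((s \*: (fun p : 'rV[R]_n.+1 => p 0 ord0)) + cst r) p.
  apply: differentiableD; last exact: differentiable_cst.
  by apply: differentiableZ; exact: differentiable_coord.
have := differentiableM (@differentiable_coord R 1 n.+1 p 0 (lift ord0 i))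
  (differentiableV dd d0).
by congr (differentiable _ _); apply/funext => v; rewrite mxE.
Qed.

(** The image of [W] is cut out by the preimage of [W] under the continuous
inverse, away from the hyperplane through the pole. *)
Lemma stereo_image_open (W : set 'rV[R]_n) : open W ->
  exists2 V : set 'rV[R]_n.+1, open V & stereo @` W = round_sphere r `&` V.
Proof.
move=> openW.
exists [set p : 'rV[R]_n.+1 | s * p 0 ord0 + r != 0 /\ W (unstereo p)].
  rewrite openE => p [d0 Wp]; rewrite /interior.
  have dd : {for p, continuous (fun p : 'rV[R]_n.+1 => s * p 0 ord0 + r)}.
    apply: continuousD; last exact: cst_continuous.
    apply: continuousM; first exact: cst_continuous.
    exact: coord_continuous.
  have near_d0 : \forall p' \near p, s * (p' : 'rV[R]_n.+1) 0 ord0 + r != 0.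
    by apply: (dd [set t | t != 0]); apply: open_nbhs_nbhs; split=> //; exact: open_neq.
  have near_W : \forall p' \near p, W (unstereo p').
    have cu := differentiable_continuous (differentiable_unstereo d0).
    by apply: cu; apply: open_nbhs_nbhs.
  exact: filterI near_d0 near_W.
apply/seteqP; split=> [p [u Wu <-]|p [/round_sphereP pS [d0 Wp]]].
  split; first by apply/round_sphereP; [exact: ltW|exact: stereo_sphere].
  split; last by rewrite stereoK.
  rewrite stereo0 !mulrA s_sign mul1r (_ : _ + _ = 2 * r * q u); last by ring.
  by rewrite !mulf_neq0 ?lt0r_neq0 // conf_gt0.
by exists (unstereo p) => //; apply: unstereoK => //; apply: pS; exact: ltW.
Qed.

Lemma stereo_local_parametrization :
  local_parametrization (round_sphere r) setT stereo.
Proof.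
split.
- exact: openT.
- exact: stereo_smooth.
(* A conformal linear map is injective. *)
- move=> u _ a b ab; apply/eqP; rewrite -subr_eq0; apply/eqP/dot_eq0.
  have := stereo_metric u (a - b) (a - b).
  rewrite /induced_metric linearB /= ab subrr dot0l => /esym/eqP.
  have c_neq0 : 4 * r ^+ 2 * q u ^+ 2 != 0.
    by rewrite lt0r_neq0 // !mulr_gt0 ?exprn_gt0 ?conf_gt0.
  by rewrite mulf_eq0 (negPf c_neq0) => /eqP.
- by move=> u v _ _ /(can_inj stereoK).
- by move=> W openW _; exact: stereo_image_open.
Qed.

Definition stereo_frame i u : 'rV[R]_n :=
  ((1 + dot u u) / (2 * r)) *: coord_vec R i.

Lemma stereo_orthonormal_frame : orthonormal_frame stereo setT stereo_frame.
Proof.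
split=> [i|u _ i j].
  apply: alg_smooth => j.
  rewrite (_ : (fun _ => _) = (cst 1 + \sum_k (fun u : 'rV[R]_n => u 0 k) ^+ 2) *
      cst ((2 * r)^-1 * coord_vec R i 0 j)).
    apply: alg_mul; last exact: alg_cst.
    apply: alg_add; first exact: alg_cst.
    by apply: alg_sum => k; rewrite expr2; apply: alg_mul; constructor.
  by apply/funext => u; rewrite -sqnormE mxE -mulrA.
rewrite stereo_metric /stereo_frame dotZl dotZr dot_coord mxE eqxx /=.
transitivity ((q u * (1 + dot u u)) ^+ 2 * (j == i)%:R).
  by field; exact: lt0r_neq0.
by rewrite confE expr1n mul1r eq_sym.
Qed.

End Stereographic.

(** * The round sphere *)

Section RoundSphere.
Variables (R : realType) (n : nat) (r : R).
Hypothesis r_gt0 : 0 < r.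

Lemma round_sphere_submanifold : submanifold n (@round_sphere R n r).
Proof.
move=> p /round_sphereP pS; have {}pS := pS (ltW r_gt0).
(* The pole [- s r] is chosen in the half-space away from [p]. *)
have [s s_sign d0] : exists2 s : R, s * s = 1 & s * p 0 ord0 + r != 0.
  have [p0|p0] := leP 0 (p 0 ord0).
    by exists 1; rewrite ?mulr1 // mul1r lt0r_neq0 // ltr_wpDl.
  by exists (-1); rewrite ?mulrNN ?mulr1 // mulN1r lt0r_neq0 // addr_gt0 ?oppr_gt0.
exists setT, (stereo r s); split; first exact: stereo_local_parametrization.
by exists (unstereo r s p) => //; exact: unstereoK.
Qed.

Lemma local_parametrization_sphere U (x : 'rV[R]_n -> 'rV[R]_n.+1) :
  local_parametrization (round_sphere r) U x ->
  forall u, U u -> dot (x u) (x u) = r ^+ 2.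
Proof.
case=> openU _ _ _ xopen u Uu; apply/round_sphereP; first exact: ltW.
have [V _ xU] := xopen U openU (@subset_refl _ U).
by have : (x @` U) (x u) by [exists u]; rewrite xU => -[].
Qed.

Hypothesis n_gt0 : (0 < n)%N.

Lemma round_sphere_biminimal :
  biminimal n (- n%:R / r ^+ 2) (@round_sphere R n r).
Proof.
move=> U x e xP eP u Uu; have [openU smx _ _ _] := xP.
exact: (biminimal_sphere_patch openU (smx 2) r_gt0
  (local_parametrization_sphere xP) eP).
Qed.

Lemma round_sphere_not_minimal : ~ minimal n (@round_sphere R n r).
Proof.
have s1 : 1 * 1 = 1 :> R by rewrite mulr1.
have xP := @stereo_local_parametrization R n r 1 r_gt0 s1.
have eP := @stereo_orthonormal_frame R n r 1 r_gt0 s1.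
move=> /(_ _ _ _ xP eP 0 I); have [openU smx _ _ _] := xP.
have HE := mean_curvature_sphere openU (smx 2) r_gt0
  (local_parametrization_sphere xP) eP n_gt0 (I : setT (0 : 'rV[R]_n)).
rewrite HE => H0; have := local_parametrization_sphere xP (I : setT (0 : 'rV_n)).
have x0 : stereo r 1 (0 : 'rV[R]_n) = 0.
  move/eqP: H0; rewrite scaler_eq0 oppr_eq0 invr_eq0 expf_eq0 /= gt_eqF //.
  by move/eqP.
by rewrite x0 dot0l => /esym/eqP; rewrite expf_eq0 /= gt_eqF.
Qed.

End RoundSphere.

Theorem proposition4p4 (R : realType) (n : nat) (lambda : R)
    (hn : (1 <= n)%N) (hlambda : lambda < 0) :
  let S := @round_sphere R n (Num.sqrt (n%:R / - lambda)) in
  [/\ submanifold n S, biminimal n lambda S & ~ minimal n S].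
Proof.
have n0 : 0 < n%:R :> R by rewrite ltr0n.
have q0 : 0 < n%:R / - lambda by rewrite divr_gt0 // oppr_gt0.
have r0 : 0 < Num.sqrt (n%:R / - lambda) by rewrite sqrtr_gt0.
split.
- exact: round_sphere_submanifold.
- rewrite (_ : biminimal n lambda = biminimal n
    (- n%:R / Num.sqrt (n%:R / - lambda) ^+ 2)); first exact: round_sphere_biminimal.
  congr (biminimal n); rewrite sqr_sqrtr; last exact: ltW.
  by field; rewrite (ltr0_neq0 hlambda) lt0r_neq0.
- exact: round_sphere_not_minimal.
Qed.
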